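(* Let $n\geq 2$, $k\geq 1$ and $l\geq 1$ be integers. Then $$n\,p_{k,l}(n) = \sum_{d=1}^{n} d\sum_{j=1}^{l}(-1)^{j+1}\sum_{i=1}^{\lfloor n/d\rfloor}\binom{i}{j}\,p_{k-i,\,l-j}(n-id),$$ $$n\,r_l(n) = \sum_{d=1}^{n} d\sum_{j=1}^{l}(-1)^{j+1}\sum_{i=1}^{\lfloor n/d\rfloor}\binom{i}{j}\,r_{l-j}(n-id),$$ where the boundary values (the cases $n=0$, $k\leq 0$ or $l\leq 0$ for $p_{k,l}(n)$, and $n=0$ or $l=0$ for $r_l(n)$) are $$p_{k,l}(n)=\begin{cases}1,&\text{if } n=k=l=0;\\ 0,&\text{otherwise,}\end{cases}\qquad r_l(n)=\begin{cases}1,&\text{if } n=l=0;\\ 0,&\text{otherwise.}\end{cases}$$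
   Context: Partitions are unordered. For positive integers $n,k,l$: $p_{k,l}(n)$ denotes the number of partitions of $n$ with exactly $k$ parts (counted with multiplicity) among which exactly $l$ different part sizes occur; $r_l(n)$ denotes the number of partitions of $n$ (with any number of parts) in which exactly $l$ different part sizes occur. The binomial coefficient $\binom{i}{j}$ is $0$ for $j>i$. *)

(* Defs.v *)
From mathcomp Require Import all_boot all_order all_algebra.

Set Implicit Arguments.
Unset Strict Implicit.
Unset Printing Implicit Defensive.

(* An (unordered) partition of n is represented by its weakly decreasing list
   of parts. *)
Definition is_partition (n : nat) (s : seq nat) : bool :=
  [&& sorted geq s, all (leq 1) s & sumn s == n].

Definition nb_part_sizes (s : seq nat) : nat := size (undup s).

(* A partition of n has at most n parts, each of size at most n (see
   partition_bounded), so the finite type n.-bseq 'I_n.+1 contains all of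
   them. *)
Definition partitions (n : nat) : {set n.-bseq 'I_n.+1} :=
  [set s : n.-bseq 'I_n.+1 | is_partition n (map val s)].

Lemma partition_bounded (n : nat) (s : seq nat) :
  is_partition n s -> exists t : n.-bseq 'I_n.+1, map val t = s.
Proof.
case/and3P=> _ pos_s /eqP sum_s.
have size_le : forall u, all (leq 1) u -> size u <= sumn u.
  by elim=> //= x u IHu /andP[x1 /IHu u1]; rewrite -add1n leq_add.
have part_le : forall u x, x \in u -> x <= sumn u.
  elim=> //= y u IHu x; rewrite inE => /predU1P[-> | /IHu xu].
    exact: leq_addr.
  exact: leq_trans xu (leq_addl _ _).
have le_n : all (fun x => x < n.+1) s.
  by apply/allP=> x /part_le; rewrite sum_s ltnS.
have val_s : map val (map (@inord n) s) = s.
  rewrite -map_comp -[RHS]map_id; apply/eq_in_map=> x /(allP le_n) /=.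
  exact: inordK.
have size_s : size (map (@inord n) s) <= n by rewrite size_map -sum_s size_le.
by exists (Bseq size_s).
Qed.

(* p k l n is p_{k,l}(n). The index k is an integer because k - i may be
   negative in the recurrence; truncated subtraction would confuse this case
   with k = 0. *)
Definition p (k l : int) (n : nat) : nat :=
  if [&& 0 < k, 0 < l & (0 < n)%N]%R then
    #|[set s in partitions n | (Posz (size s) == k)
                             & (Posz (nb_part_sizes (map val s)) == l)]|
  else [&& n == 0, k == 0%R & l == 0%R].

Definition r (l n : nat) : nat :=
  if (0 < l) && (0 < n) then
    #|[set s in partitions n | nb_part_sizes (map val s) == l]|
  else (n == 0) && (l == 0).

(* Main.v *)
Require Import Defs.
From mathcomp Require Import all_boot all_order all_algebra.
From mathcomp Require Import zify.
Local Open Scope ring_scope.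

Import GRing.Theory.

(** Both identities say that q d/dq acts on the generating function
    F = prod_d (1 + y (x q^d + x^2 q^(2d) + ...)) of partitions by number of
    parts (x) and number of part sizes (y) as multiplication by the sum over d
    of d (1 - (1 - y)^i) x^i q^(id); the proof is the combinatorial content of
    this logarithmic derivative.

    A partition s of n satisfies n = sum_d d * m_d(s), where m_d(s) is the
    multiplicity of d in s (sum_mul_count).  It therefore suffices to compute,
    for every d, the sum of m_d(s) over the partitions s counted on the left
    (wcount_mark_part).  Adding i copies of d is a bijection from the
    partitions of n - id onto the partitions s of n with m_d(s) >= i
    (add_copies_parts).  It adds i parts, and a new part size exactly when
    m_d(s) = i (nb_part_sizes_add_copies).  Transported along it, the d-th
    summand on the right, apart from its factor d, becomes a sum over the
    partitions s of n in which s, with m = m_d(s) and c part sizes, receives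
    the coefficient

      sum_(1 <= j <= l) (-1)^(j+1) sum_(1 <= i <= m) 'C(i, j) [c = l - j + [m = i]].

    By the hockey-stick identity the terms with i < m contribute 'C(m, j+1)
    when c + j = l, and the term i = m contributes 'C(m, j) when c + j = l + 1.
    With alternating signs the sum over j telescopes to m [c = l]
    (alternating_bin_sum), which is what the left-hand side requires.

    The number of parts enters only through a weight A that is evaluated at it;
    the indicator of k gives the identity for p, and the constant 1 the one
    for r (p_wcount, r_wcount). *)

(** * Partitions as lists and weighted counts *)

Definition parts (n : nat) : seq (seq nat) :=
  [seq map val (s : seq 'I_n.+1) | s : n.-bseq 'I_n.+1 in partitions n].

Lemma mem_parts n s : (s \in parts n) = is_partition n s.
Proof.
apply/imageP/idP => [[t] | s_n]; first by rewrite inE => t_n ->.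
have [t def_s] := partition_bounded s_n.
by exists t; rewrite // inE def_s.
Qed.

Lemma parts_uniq n : uniq (parts n).
Proof.
rewrite map_inj_uniq ?enum_uniq //.
by move=> s t /(inj_map val_inj) /val_inj.
Qed.

Lemma card_partitions_sum n (P : pred (seq nat)) :
  #|[set s in partitions n | P (map val (s : seq 'I_n.+1))]|%:Z =
  \sum_(s <- parts n) (P s)%:R.
Proof.
rewrite big_image /= -sum1_card -natz natr_sum big_mkcond [RHS]big_mkcond /=.
by apply: eq_bigr => s _; rewrite inE; case: (s \in _) => //=; case: (P _).
Qed.

Lemma partition_nil n s : is_partition n s -> (s == [::]) = (n == 0)%N.
Proof.
by case/and3P=> _ pos_s /eqP <-; case: s pos_s => //= x s; case: x.
Qed.

Lemma nb_part_sizes_eq0 s : (nb_part_sizes s == 0)%N = (s == [::]).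
Proof.
by rewrite /nb_part_sizes size_eq0; apply/eqP/eqP => [/undup_nil | ->].
Qed.

(** The weight A on the number of parts lets a single recurrence cover both p
    and r. The recurrence itself replaces A by its shifts, so that the index
    k - i never has to be formed as a natural number. *)
Definition wcount (A : nat -> int) (l n : nat) : int :=
  \sum_(s <- parts n) A (size s) * (nb_part_sizes s == l)%:R.

(** The prescribed boundary values of p and r are those of an honest count: the
    empty partition is the only partition of 0 and the only one without part
    sizes. *)
Lemma wcount_boundary A l n :
  ~~ ((0 < l) && (0 < n))%N -> wcount A l n = A 0%N * ((n == 0) && (l == 0))%N%:R.
Proof.
rewrite /wcount => l0n0; have [n0 | n_gt0] := posnP n.
  have ->: parts n = [:: [::]].
    apply: perm_small_eq => //; apply: uniq_perm => // [|s].
      exact: parts_uniq.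
    rewrite mem_parts inE; apply/idP/idP => [/partition_nil ->|/eqP->].
      by rewrite n0.
    by rewrite n0.
  by rewrite big_seq1 /nb_part_sizes /= eq_sym.
have l0 : l = 0%N by move: l0n0; rewrite n_gt0 andbT; case: (l).
rewrite mulr0 big_seq big1 // => s; rewrite mem_parts => /partition_nil.
by rewrite l0 nb_part_sizes_eq0 (gtn_eqF n_gt0) => ->; rewrite mulr0.
Qed.

Lemma r_wcount l n : (r l n)%:Z = wcount (fun=> 1) l n.
Proof.
rewrite /r; case: ifPn => [_ | /wcount_boundary->]; last by rewrite mul1r natz.
rewrite (card_partitions_sum n (fun s => nb_part_sizes s == l)).
by apply: eq_bigr => s _; rewrite mul1r.
Qed.

Lemma p_wcount (k : int) (l n : nat) :
  (p k l%:Z n)%:Z = wcount (fun m => (m%:Z == k)%:R) l n.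
Proof.
rewrite /p; case: ifPn => [_ | k0].
  under eq_finset => s do rewrite -[size s](size_map val).
  rewrite (card_partitions_sum n (fun s => (Posz (size s) == k) &&
    (Posz (nb_part_sizes s) == l%:Z))).
  by apply: eq_bigr => s _; rewrite -natrM mulnb.
have [/andP[l_gt0 n_gt0] | /wcount_boundary->] := boolP ((0 < l) && (0 < n))%N.
  move: k0; rewrite ltz_nat l_gt0 n_gt0 !andbT => k_le0.
  rewrite (gtn_eqF n_gt0) /wcount big_seq big1 // => s.
  rewrite mem_parts => /partition_nil; rewrite (gtn_eqF n_gt0).
  case: s => //= x s _; have [k_s | _] := eqP; last by rewrite mul0r.
  by rewrite -k_s in k_le0.
by rewrite -natrM mulnb natz andbCA [0%Z == k]eq_sym.
Qed.

(** * Adding copies of a part *)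

Definition add_copies (i d : nat) (s : seq nat) : seq nat :=
  sort geq (nseq i d ++ s).

Lemma perm_add_copies i d s : perm_eql (add_copies i d s) (nseq i d ++ s).
Proof. exact/permPl/permEl/perm_sort. Qed.

Lemma geq_sortedP s t : sorted geq s -> sorted geq t -> perm_eq s t -> s = t.
Proof.
apply: sorted_eq => [x y z /= yx zy | x y /= /andP[xy yx]].
  exact: leq_trans zy yx.
by apply/eqP; rewrite eqn_leq xy yx.
Qed.

Lemma sort_geq_sorted s : sorted geq (sort geq s).
Proof. by apply: sort_sorted => x y; apply: leq_total. Qed.

Lemma is_partition_sort n s :
  is_partition n (sort geq s) = all (leq 1) s && (sumn s == n).
Proof.
have s_s : perm_eq (sort geq s) s by rewrite perm_sort.
by rewrite /is_partition sort_geq_sorted (perm_all _ s_s) (perm_sumn s_s).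
Qed.

(** Isolating the copies of d gives both the inverse of adding copies and the
    bound on the multiplicity of d. *)
Lemma perm_count_mem (T : eqType) (d : T) s :
  perm_eq s (nseq (count_mem d s) d ++ filter (predC1 d) s).
Proof.
have /all_pred1P def_d := filter_all (pred1 d) s.
by rewrite -size_filter -def_d perm_sym perm_filterC.
Qed.

(** The inverse map removes i copies of d. *)
Lemma add_copies_parts i d n : (0 < d)%N -> (i * d <= n)%N ->
  perm_eq [seq s <- parts n | i <= count_mem d s]%N
          (map (add_copies i d) (parts (n - i * d))).
Proof.
move=> d_gt0 id_n; apply: uniq_perm.
- exact/filter_uniq/parts_uniq.
- rewrite map_inj_in_uniq ?parts_uniq // => s t.
  rewrite !mem_parts => /and3P[s_s _ _] /and3P[s_t _ _] eq_st.
  apply: geq_sortedP => //.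
  by rewrite -(perm_cat2l (nseq i d)) -perm_add_copies eq_st perm_add_copies.
move=> s; rewrite mem_filter; apply/andP/mapP => [[i_s] | [t]].
  rewrite mem_parts => /and3P[s_s s_pos /eqP sum_s].
  pose t := nseq (count_mem d s - i) d ++ filter (predC1 d) s.
  have s_t : perm_eq s (nseq i d ++ t).
    by rewrite /t catA -nseqD subnKC // perm_count_mem.
  exists (sort geq t).
    rewrite mem_parts is_partition_sort; move: s_pos.
    rewrite (perm_all _ s_t) all_cat => /andP[_ ->] /=.
    by rewrite -sum_s (perm_sumn s_t) sumn_cat sumn_nseq mulnC addKn.
  apply: geq_sortedP => //; first exact: sort_geq_sorted.
  rewrite perm_sym perm_add_copies perm_sym (perm_trans s_t) //.
  by rewrite perm_cat2l perm_sym perm_sort.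
rewrite mem_parts => /and3P[_ t_pos /eqP sum_t] ->; split.
  rewrite (permP (permEl (perm_add_copies i d t))) count_cat count_nseq /=.
  by rewrite eqxx mul1n leq_addr.
rewrite mem_parts is_partition_sort all_cat t_pos all_nseq d_gt0 orbT /=.
by rewrite sumn_cat sumn_nseq sum_t mulnC subnKC.
Qed.

(** Adding d creates a new part size iff d was absent before, that is, iff the
    i added copies are the only ones. The correction is expressed through the
    resulting partition because the sums are carried over to it. *)
Lemma nb_part_sizes_add_copies i d s : (0 < i)%N ->
  nb_part_sizes (add_copies i d s) =
    (nb_part_sizes s + (count_mem d (add_copies i d s) == i))%N.
Proof.
move=> i_gt0; rewrite (permP (permEl (perm_add_copies i d s))) count_cat.
rewrite count_nseq /= eqxx mul1n -{3}[i]addn0 eqn_add2l -leqn0 leqNgt -has_count.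
rewrite has_pred1 /nb_part_sizes.
have /perm_size-> : perm_eq (undup (add_copies i d s)) (undup (d :: s)).
  apply: uniq_perm => [||x]; rewrite ?undup_uniq // !mem_undup.
  by rewrite mem_sort mem_cat mem_nseq i_gt0 inE.
by rewrite /=; case: (d \in s); rewrite /= ?addn0 ?addn1.
Qed.

(** * The coefficient of a partition *)

Lemma sum_mul_count n s : all (fun x => 1 <= x <= n)%N s ->
  (\sum_(1 <= d < n.+1) d * count_mem d s = sumn s)%N.
Proof.
elim: s => /= [_ | x s IHs /andP[x_n /IHs <-]].
  by rewrite big1 // => d _; rewrite muln0.
under eq_bigr do rewrite mulnDr; rewrite big_split /=; congr addn.
rewrite (bigD1_seq x) ?iota_uniq ?mem_index_iota //= eqxx muln1 big1 ?addn0 //.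
by move=> d; rewrite eq_sym => /negPf->; rewrite muln0.
Qed.

Lemma sum_bin m j : (\sum_(0 <= i < m) 'C(i, j) = 'C(m, j.+1))%N.
Proof.
elim: m => [|m IHm]; first by rewrite big_geq.
by rewrite big_nat_recr // IHm binS.
Qed.

(** Here m is the multiplicity of the marked part in a partition and s the
    number of its part sizes. The hypothesis excludes s = 0 < m, where the
    upper end of the telescoping sum would leave +-'C(m, l+1). *)
Lemma alternating_bin_sum m s l : (0 < m -> 0 < s)%N ->
  \sum_(1 <= j < l.+1) (-1) ^+ j.+1 *
    (\sum_(1 <= i < m.+1) 'C(i, j)%:Z * (s == l - j + (m == i))%N%:R) =
  m%:Z * (s == l)%:R :> int.
Proof.
case: m => [_ | m s_gt0].
  by rewrite mul0r big1 // => j _; rewrite big_geq // mulr0.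
(* The i < m.+1 part of the j-th term is T j.+1 and its i = m.+1 part is - T j. *)
pose T j : int := (-1) ^+ j * 'C(m.+1, j)%:Z * (s + j == l.+1)%N%:R.
transitivity (\sum_(1 <= j < l.+1) (T j.+1 - T j)); last first.
  rewrite telescope_sumr // /T bin1 addn1 eqSS -[X in (s + X)%N]add1n addnA.
  rewrite [(s + 1)%N]addn1 -{2}[l.+1]add1n.
  have /negPf->: (s.+1 + l != 1 + l)%N by rewrite eqn_add2r eqSS -lt0n s_gt0.
  by rewrite mulr0 sub0r expr1 mulN1r mulNr opprK.
apply: eq_big_nat => j /andP[j_gt0 j_l].
rewrite big_nat_recr //= eqxx.
have -> : \sum_(1 <= i < m.+1) 'C(i, j)%:Z * (s == l - j + (m.+1 == i))%N%:R
   = 'C(m.+1, j.+1)%:Z * (s + j == l)%N%:R :> int.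
  rewrite -sum_bin big_ltn // bin0n gtn_eqF // add0n -natz natr_sum mulr_suml.
  apply: eq_big_nat => i /andP[_ i_m]; rewrite !natz [m.+1 == i]gtn_eqF // addn0.
  by have -> : (s == l - j)%N = (s + j == l)%N by lia.
have -> : (s == l - j + true)%N = (s + j == l.+1)%N by lia.
by rewrite /T addnS eqSS mulrDr !mulrA exprS !mulN1r !mulNr.
Qed.

(** * The recurrence *)

(** The contribution of a single d: the partitions are counted with one copy of
    d marked. *)
Lemma wcount_mark_part A l n d : (0 < d)%N ->
  \sum_(s <- parts n)
     A (size s) * (nb_part_sizes s == l)%:R * (count_mem d s)%:Z =
  \sum_(1 <= j < l.+1) (-1) ^+ j.+1 *
    \sum_(1 <= i < (n %/ d).+1)
      'C(i, j)%:Z * wcount (fun m => A (i + m)%N) (l - j) (n - i * d).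
Proof.
move=> d_gt0.
transitivity (\sum_(s <- parts n) A (size s) *
   \sum_(1 <= j < l.+1) (-1) ^+ j.+1 *
     (\sum_(1 <= i < (n %/ d).+1)
        if (i <= count_mem d s)%N then 'C(i, j)%:Z *
          (nb_part_sizes s == l - j + (count_mem d s == i))%N%:R else 0)).
  apply: eq_big_seq => s; rewrite mem_parts => s_n.
  (* The range i <= n / d contains every i <= m_d(s), so cutting it down to the
     latter loses nothing. *)
  have m_n : (count_mem d s <= n %/ d)%N.
    rewrite leq_divRL //; case/and3P: s_n => _ _ /eqP <-.
    rewrite [leqRHS](perm_sumn (perm_count_mem _ d s)) sumn_cat sumn_nseq mulnC.
    exact: leq_addr.
  have m_s : (0 < count_mem d s -> 0 < nb_part_sizes s)%N.
    by rewrite lt0n [(0 < _)%N]lt0n nb_part_sizes_eq0; case: (s).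
  rewrite -mulrA [_%:R * _]mulrC -alternating_bin_sum //; congr (_ * _).
  apply: eq_bigr => j _; congr (_ * _).
  by rewrite (big_nat_widen _ _ (n %/ d).+1) // big_mkcond.
under eq_bigr do rewrite mulr_sumr.
rewrite exchange_big; apply: eq_bigr => j _ /=.
under eq_bigr do rewrite mulrCA.
rewrite -mulr_sumr; congr (_ * _).
transitivity (\sum_(1 <= i < (n %/ d).+1) \sum_(s <- parts n) A (size s) *
    if (i <= count_mem d s)%N then 'C(i, j)%:Z *
      (nb_part_sizes s == l - j + (count_mem d s == i))%N%:R else 0).
  by rewrite exchange_big; apply: eq_bigr => s _; rewrite mulr_sumr.
apply: eq_big_nat => i /andP[i_gt0 i_n] /=.
have id_n : (i * d <= n)%N by rewrite -leq_divRL.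
transitivity (\sum_(s <- [seq s <- parts n | i <= count_mem d s]%N)
   'C(i, j)%:Z * (A (size s) *
     (nb_part_sizes s == l - j + (count_mem d s == i))%N%:R)).
  rewrite big_filter [RHS]big_mkcond; apply: eq_bigr => s _.
  by case: ifP => _; rewrite ?mulr0 // mulrCA.
rewrite -mulr_sumr (perm_big _ (add_copies_parts i d n d_gt0 id_n)) big_map.
congr (_ * _); apply: eq_bigr => s _.
rewrite nb_part_sizes_add_copies // eqn_add2r.
by rewrite (perm_size (permEl (perm_add_copies i d s))) size_cat size_nseq.
Qed.

Lemma wcount_recurrence A l n :
  n%:Z * wcount A l n =
    \sum_(1 <= d < n.+1) d%:Z *
      \sum_(1 <= j < l.+1) (-1) ^+ j.+1 *
        \sum_(1 <= i < (n %/ d).+1)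
          'C(i, j)%:Z * wcount (fun m => A (i + m)%N) (l - j) (n - i * d).
Proof.
under eq_big_nat => d /andP[d_gt0 _].
  rewrite -wcount_mark_part // mulr_sumr.
over.
rewrite exchange_big mulr_sumr; apply: eq_big_seq => s.
rewrite mem_parts => /and3P[_ s_pos /eqP sum_s].
under eq_bigr do rewrite mulrCA.
rewrite -mulr_sumr mulrC; congr (_ * _).
under eq_bigr do rewrite -PoszM -natz.
rewrite -natr_sum natz sum_mul_count ?sum_s //.
apply/allP => x x_s; rewrite (allP s_pos) //= -sum_s.
by rewrite (perm_sumn (perm_to_rem x_s)) leq_addr.
Qed.

Theorem corollary9 (n k l : nat)
  (hn : (2 <= n)%N) (hk : (1 <= k)%N) (hl : (1 <= l)%N) :
  n%:Z * (p k%:Z l%:Z n)%:Z =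
    \sum_(1 <= d < n.+1) d%:Z *
      \sum_(1 <= j < l.+1) (-1) ^+ j.+1 *
        \sum_(1 <= i < (n %/ d).+1)
          'C(i, j)%:Z * (p (k%:Z - i%:Z) (l%:Z - j%:Z) (n - i * d))%:Z
  /\
  n%:Z * (r l n)%:Z =
    \sum_(1 <= d < n.+1) d%:Z *
      \sum_(1 <= j < l.+1) (-1) ^+ j.+1 *
        \sum_(1 <= i < (n %/ d).+1)
          'C(i, j)%:Z * (r (l - j) (n - i * d))%:Z.
Proof.
split.
  rewrite p_wcount wcount_recurrence.
  apply: eq_bigr => d _; congr (_ * _); apply: eq_big_nat => j /andP[_ j_l].
  congr (_ * _); apply: eq_bigr => i _; congr (_ * _).
  rewrite [l%:Z - _]subzn // p_wcount; apply: eq_bigr => s _.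
  by have -> : ((i + size s)%:Z == k%:Z) = ((size s)%:Z == k%:Z - i%:Z) by lia.
rewrite r_wcount wcount_recurrence.
apply: eq_bigr => d _; congr (_ * _); apply: eq_bigr => j _.
by congr (_ * _); apply: eq_bigr => i _; rewrite r_wcount.
Qed.
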